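(* Let $(\Omega,\mathcal{F},P)$ be a probability space, $K\in\{\mathbb{R},\mathbb{C}\}$, and let $(E,\mathcal{T})$ be a topological $L^{0}(\mathcal{F},K)$-module. Then the following two statements are equivalent: (1) The topology $\mathcal{T}$ can be induced by a family of $L^0$-seminorms on $E$. (2) There exists a neighborhood base $\mathcal{U}$ of $0\in E$ such that each $U\in\mathcal{U}$ is an $L^0$-convex, $L^0$-absorbent and $L^0$-balanced subset of $E$ with the relative countable concatenation property.
   Context: $L^{0}(\mathcal{F},K)$ is the algebra of equivalence classes (modulo $P$-almost sure equality) of $K$-valued $\mathcal{F}$-measurable random variables on $\Omega$; $L^0=L^0(\mathcal{F},\mathbb{R})$, partially ordered by $\xi\leqslant\eta$ iff $\xi\le\eta$ $P$-almost surely. $L^0_+=\{\xi\in L^0:\xi\geqslant 0\}$ and $L^0_{++}=\{\xi\in L^0:\xi>0\ P\text{-a.s. on }\Omega\}$. For $\xi\in L^0(\mathcal{F},K)$, $|\xi|\in L^0_+$ is the class of the pointwise absolute value. For $A\in\mathcal{F}$, $\tilde I_A$ is the equivalence class of the characteristic function of $A$. For $\varepsilon\in L^0_{++}$ let $B_\varepsilon=\{\xi\in L^0(\mathcal{F},K):|\xi|\leqslant\varepsilon\}$. The topology $\mathcal{T}_c$ on $L^0(\mathcal{F},K)$ consists of all $V\subset L^0(\mathcal{F},K)$ such that for every $y\in V$ there is $\varepsilon\in L^0_{++}$ with $y+B_\varepsilon\subset V$; with it, $L^0(\mathcal{F},K)$ is a topological ring. A topological $L^0(\mathcal{F},K)$-module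 $(E,\mathcal{T})$ is an $L^0(\mathcal{F},K)$-module $E$ with a topology $\mathcal{T}$ such that addition $(E,\mathcal{T})\times(E,\mathcal{T})\to(E,\mathcal{T})$ and module multiplication $(L^0(\mathcal{F},K),\mathcal{T}_c)\times(E,\mathcal{T})\to(E,\mathcal{T})$ are continuous for the product topologies. A subset $U\subset E$ is: $L^0$-convex if $\xi x_1+(1-\xi)x_2\in U$ for all $x_1,x_2\in U$ and $\xi\in L^0$ with $0\leqslant\xi\leqslant1$; $L^0$-absorbent if for every $x\in E$ there is $\xi\in L^0_{++}$ with $x\in\xi U$; $L^0$-balanced if $\xi x\in U$ for all $x\in U$ and $\xi\in L^0(\mathcal{F},K)$ with $|\xi|\leqslant1$. An $L^0$-seminorm on $E$ is a function $\|\cdot\|:E\to L^0_+$ with $\|\xi x\|=|\xi|\,\|x\|$ for all $\xi\in L^0(\mathcal{F},K)$, $x\in E$, and $\|x_1+x_2\|\leqslant\|x_1\|+\|x_2\|$ for all $x_1,x_2\in E$. For a family $\mathcal{P}$ of $L^0$-seminorms on $E$, a finite $\mathcal{Q}\subset\mathcal{P}$ and $\varepsilon\in L^0_{++}$, let $U_{\mathcal{Q},\varepsilon}=\{x\in E:\|x\|\leqslant\varepsilon\ \text{for all } \|\cdot\|\in\mathcal{Q}\}$. The topology induced by $\mathcal{P}$ is the (translation-invariant) topology on $E$ for which $\{U_{\mathcal{Q},\varepsilon}:\mathcal{Q}\subset\mathcal{P}\text{ finite},\ \varepsilon\in L^0_{++}\}$ is a neighborhood base of $0$, i.e. $V\subset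 E$ is open iff for every $y\in V$ there are such $\mathcal{Q},\varepsilon$ with $y+U_{\mathcal{Q},\varepsilon}\subset V$. A countable partition of $\Omega$ to $\mathcal{F}$ is a sequence $\{A_n,n\in\mathbb{N}\}$ of pairwise disjoint members of $\mathcal{F}$ with union $\Omega$. For a sequence $\{x_n,n\in\mathbb{N}\}$ in $E$ and such a partition, let $\sum_{n=1}^\infty\tilde I_{A_n}x_n$ denote the set of all $x\in E$ with $\tilde I_{A_n}x=\tilde I_{A_n}x_n$ for every $n\in\mathbb{N}$; the sequence is countably concatenated in $E$ with respect to $\{A_n\}$ if this set is nonempty. (It is not assumed that this set has at most one element.) A subset $G\subset E$ has the relative countable concatenation property if for every sequence $\{x_n\}$ in $G$ and every countable partition $\{A_n\}$ of $\Omega$ to $\mathcal{F}$, one has $\sum_{n=1}^\infty\tilde I_{A_n}x_n\subset G$ whenever $\{x_n\}$ is countably concatenated in $E$ with respect to $\{A_n\}$. *)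

(* Defs.v *)
From HB Require Import structures.
From mathcomp Require Import all_boot all_order all_algebra.
From mathcomp Require Import complex.
From mathcomp Require Import all_classical all_reals all_analysis.
Set Implicit Arguments.
Unset Strict Implicit.
Unset Printing Implicit Defensive.
Import Order.TTheory GRing.Theory Num.Theory.
Import numFieldNormedType.Exports.
Local Open Scope classical_set_scope.
Local Open Scope ring_scope.

Variant scalar_kind := RealScalars | ComplexScalars.

Definition scalar_field (R : realType) (k : scalar_kind) : numFieldType :=
  match k with
  | RealScalars => R
  | ComplexScalars => R[i]
  end.

(* The norm of a numFieldType takes its values in the field itself, here in
   R[i] for complex scalars; modulus is the R-valued absolute value. *)
Definition modulus (R : realType) (k : scalar_kind) : scalar_field R k -> R :=
  match k return scalar_field R k -> R with
  | RealScalars => fun x => `|x|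
  | ComplexScalars => fun z => ComplexField.Normc.normc z
  end.

Definition of_real (R : realType) (k : scalar_kind) : R -> scalar_field R k :=
  match k return R -> scalar_field R k with
  | RealScalars => fun x => x
  | ComplexScalars => fun x => real_complex R x
  end.
Arguments of_real {R} k x.

(* K with its Borel sigma-algebra. *)
Definition borel (K : numFieldType) := g_sigma_algebraType (@open K).

Lemma epsilon_delta_continuous (K L : numFieldType) (h : K -> L) :
  (forall x e, 0 < e -> exists2 r, 0 < r &
    forall y, `|x - y| < r -> `|h x - h y| < e) -> continuous h.
Proof.
move=> H x; apply/(@cvgrPdist_lt _ L _ (nbhs x)) => e /(H x)[r r0 hr].
by apply/nbhs_normP; exists r => // y /= /hr.
Qed.

Section Scalar.
Context (R : realType).
Implicit Types k : scalar_kind.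

Lemma norm_scalar k (x : scalar_field R k) : `|x| = of_real k (modulus x).
Proof. by case: k x => [//|[a b]]. Qed.

Lemma of_real_lt k (x y : R) : (of_real k x < of_real k y) = (x < y).
Proof. by case: k => //=; rewrite ltcR. Qed.

Lemma of_real_le k (x y : R) : (of_real k x <= of_real k y) = (x <= y).
Proof. by case: k => //=; rewrite lecR. Qed.

Lemma of_realB k (x y : R) : of_real k (x - y) = of_real k x - of_real k y.
Proof. by case: k => //=; rewrite rmorphB. Qed.

Lemma of_realD k (x y : R) : of_real k (x + y) = of_real k x + of_real k y.
Proof. by case: k => //=; rewrite rmorphD. Qed.

Lemma modulus_of_real k (x : R) : modulus (of_real k x) = `|x|.
Proof.
case: k => //=.
by rewrite expr0n/= addr0 sqrtr_sqr.
Qed.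

Lemma pos_of_real k (e : scalar_field R k) : 0 < e ->
  exists2 r : R, 0 < r & of_real k r = e.
Proof.
case: k e => [|[a b]] /=; first by move=> e e0; exists e.
by rewrite ltcE/= => /andP[/eqP -> a0]; exists a.
Qed.

Lemma modulus_sub k (x y : scalar_field R k) :
  `|modulus x - modulus y| <= modulus (x - y).
Proof.
by have := ler_dist_dist x y;
  rewrite !norm_scalar -of_realB modulus_of_real of_real_le.
Qed.

Lemma continuous_modulus k : continuous (@modulus R k : scalar_field R k -> R).
Proof.
apply: epsilon_delta_continuous => x e e0.
exists (of_real k e) => [|y].
  have -> : 0 = of_real k 0 by case: (k).
  by rewrite of_real_lt.
rewrite norm_scalar of_real_lt; exact: le_lt_trans (modulus_sub _ _).
Qed.

Lemma continuous_of_real k : continuous (of_real k : R -> scalar_field R k).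
Proof.
apply: epsilon_delta_continuous => x _ /pos_of_real[e e0 <-].
exists e => // y xy.
by rewrite -of_realB norm_scalar modulus_of_real of_real_lt.
Qed.

Lemma scalar_countable_base k : exists B : nat -> set (scalar_field R k),
  (forall n, open (B n)) /\
  forall (x : scalar_field R k) (U : set (scalar_field R k)), nbhs x U ->
    exists n, B n x /\ B n `<=` U.
Proof.
have [c c_dense] : exists c : nat -> scalar_field R k,
    forall x (r : R), 0 < r -> exists n, modulus (c n - x) < r.
  have dr (x r : R) : 0 < r -> exists q : rat, `|ratr q - x| < r.
    move=> r0.
    have [|y [xy [q _ qy]]] := @dense_rat R (ball x r) _ (ball_open x r).
      by exists x; exact: ballxx.
    by exists q; rewrite qy distrC.
  case: k.
    exists (fun n => if unpickle n is Some q then ratr q else 0) => x r r0.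
    have [q qx] := dr x r r0.
    by exists (pickle q); rewrite pickleK.
  exists (fun n => if unpickle n is Some (p, q)
     then Complex (ratr p) (ratr q) else 0) => -[a b] r r0.
  have r20 : 0 < r / 2 by rewrite divr_gt0.
  have [p pa] := dr a _ r20.
  have [q qb] := dr b _ r20.
  exists (pickle (p, q)); rewrite pickleK/=.
  apply: le_lt_trans (_ : `|ratr p - a| + `|ratr q - b| < r).
    rewrite -(@ler_pXn2r _ 2) ?nnegrE ?sqrtr_ge0 ?addr_ge0//.
    rewrite sqr_sqrtr ?addr_ge0 ?sqr_ge0// [leRHS]sqrrD !real_normK ?num_real//.
    rewrite -addrA lerD2l lerDr.
    by rewrite mulrn_wge0 ?mulr_ge0.
  by rewrite [ltRHS](splitr r) ltrD.
pose B n : set (scalar_field R k) := if unpickle n is Some (m, j) then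
  ball (c m) (of_real k j.+1%:R^-1) else set0.
exists B; split=> [n|x U].
  by rewrite /B; case: unpickle => [[m j]|]; [exact: ball_open|exact: open0].
move=> /nbhs_normP[_ /pos_of_real[e e0 <-]] eU.
have e20 : 0 < e / 2 by rewrite divr_gt0.
have [j je] : exists j, (j.+1%:R^-1 : R) < e / 2.
  exists (Num.truncn (e / 2)^-1).
  rewrite invf_plt ?posrE//.
  by rewrite truncnS_gt.
have [m mx] := c_dense x j.+1%:R^-1 ltac:(by rewrite invr_gt0).
exists (pickle (m, j)); rewrite /B pickleK/= -ball_normE; split=> [|y] /=.
  by rewrite norm_scalar of_real_lt.
rewrite norm_scalar of_real_lt => my.
apply: eU; rewrite /= norm_scalar of_real_lt -(of_real_lt k) -norm_scalar.
have -> : x - y = (x - c m) + (c m - y) by rewrite addrA subrK.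
apply: le_lt_trans (ler_normD _ _) _.
rewrite distrC !norm_scalar -of_realD of_real_lt.
by rewrite [ltRHS](splitr e) ltrD// (lt_trans _ je).
Qed.

Lemma open_measurable_borel (K : numFieldType) (U : set K) :
  open U -> measurable (U : set (borel K)).
Proof. exact: sub_sigma_algebra. Qed.

Context d (T : measurableType d).

Lemma measurable_fun_borel (K : numFieldType) (f : T -> borel K) :
  (forall U : set K, open U -> measurable (f @^-1` U)) ->
  measurable_fun setT f.
Proof.
move=> fo; apply: (@measurability _ _ T (borel K) setT f (@open K) erefl).
by move=> _ [U oU <-]; rewrite setTI; exact: fo.
Qed.

Lemma borel_measurable_comp (K L : numFieldType) (h : K -> L)
    (f : T -> borel K) :
  continuous h -> measurable_fun setT f ->
  measurable_fun setT (h \o f : T -> borel L).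
Proof.
move=> /continuousP hc mf; apply: measurable_fun_borel => U /hc oU.
rewrite comp_preimage -[_ @^-1` _]setTI; apply: mf => //.
exact: open_measurable_borel.
Qed.

Lemma borel_measurable_comp2 k1 k2 (L : numFieldType)
    (h : scalar_field R k1 * scalar_field R k2 -> L)
    (f : T -> borel (scalar_field R k1)) (g : T -> borel (scalar_field R k2)) :
  continuous h -> measurable_fun setT f -> measurable_fun setT g ->
  measurable_fun setT ((fun w => h (f w, g w)) : T -> borel L).
Proof.
move=> /continuousP hc mf mg; apply: measurable_fun_borel => U /hc oU.
have [B [Bo Bb]] := scalar_countable_base k1.
have [C [Co Cb]] := scalar_countable_base k2.
rewrite [X in measurable X](_ : _ = \bigcup_i \bigcup_j
    (if `[< B i `*` C j `<=` h @^-1` U >]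
     then f @^-1` B i `&` g @^-1` C j else set0)); last first.
  apply/seteqP; split=> [w Uw|w [i _ [j _]]]; last first.
    by case: asboolP => // BCU [Bw Cw]; exact: (BCU (f w, g w)).
  have /= [[V W] /= [fV gW] VWU] : nbhs (f w, g w) (h @^-1` U).
    exact: open_nbhs_nbhs.
  have [i [Bi BiV]] := Bb _ _ fV.
  have [j [Cj CjW]] := Cb _ _ gW.
  exists i => //; exists j => //; case: asboolP => // nBC.
  by exfalso; apply: nBC => -[y z] /= [By Cz]; apply: VWU; split;
    [exact: BiV|exact: CjW].
apply: bigcup_measurable => i _; apply: bigcup_measurable => j _.
case: asboolP => // _; apply: measurableI; rewrite -[_ @^-1` _]setTI.
- by apply: mf => //; exact: open_measurable_borel.
- by apply: mg => //; exact: open_measurable_borel.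
Qed.

End Scalar.

Section L0.
Context d (T : measurableType d) (R : realType) (P : probability T R).
Implicit Types k : scalar_kind.

Definition L0 k : Type := {mfun_ P, T >-> borel (scalar_field R k)}.

HB.instance Definition _ k := Choice.on (L0 k).

(* The pointwise values of a chosen representative. *)
Definition L0_fun k (x : L0 k) : T -> scalar_field R k := aqEqMfun_to_fun x.
Coercion L0_fun : L0 >-> Funclass.

Section Class.
Context (k : scalar_kind) (f : T -> borel (scalar_field R k))
  (mf : measurable_fun setT f).

HB.instance Definition _ :=
  isMeasurableFun.Build _ _ T (borel (scalar_field R k)) f mf.

Definition L0_class : L0 k := \pi_({mfun_ P, T >-> borel (scalar_field R k)})%qT
  (f : {mfun T >-> borel (scalar_field R k)}).

Lemma L0_classE : \forall w \ae P, L0_class w = f w.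
Proof.
have /eqmodP/asboolP :
    (repr L0_class = f %[mod {mfun_ P, T >-> borel (scalar_field R k)}])%qT.
  by rewrite reprK.
by apply: filterS => w; exact.
Qed.

End Class.

Lemma L0_measurable k (x : L0 k) :
  measurable_fun setT (x : T -> borel (scalar_field R k)).
Proof. exact: (measurable_funPT (repr x)). Qed.

Lemma L0_eqP k (x y : L0 k) : (\forall w \ae P, x w = y w) -> x = y.
Proof.
move=> xy; rewrite -[x]reprK -[y]reprK; apply/eqmodP/asboolP.
by apply: filterS xy.
Qed.

Section Lift.
Context (k : scalar_kind).

Let measurable_comp2 k1 k2 k3
    (h : scalar_field R k1 * scalar_field R k2 -> scalar_field R k3)
    (hc : continuous h) (x : L0 k1) (y : L0 k2) :
  measurable_fun setT
    ((fun w => h (x w, y w)) : T -> borel (scalar_field R k3)).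
Proof.
by apply: borel_measurable_comp2 => //; exact: L0_measurable.
Qed.

Let measurable_comp k1 k2 (h : scalar_field R k1 -> scalar_field R k2)
    (hc : continuous h) (x : L0 k1) :
  measurable_fun setT ((fun w => h (x w)) : T -> borel (scalar_field R k2)).
Proof.
by apply: (@borel_measurable_comp _ T _ _ h x) => //; exact: L0_measurable.
Qed.

Lemma measurable_L0_cst (c : scalar_field R k) :
  measurable_fun setT ((fun=> c) : T -> borel (scalar_field R k)).
Proof. exact: measurable_cst. Qed.

Lemma measurable_L0_add (x y : L0 k) :
  measurable_fun setT ((fun w => x w + y w) : T -> borel (scalar_field R k)).
Proof.
apply: (@measurable_comp2 k k k (fun z => z.1 + z.2)) => z.
by apply: cvgD; [exact: cvg_fst|exact: cvg_snd].
Qed.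

Lemma measurable_L0_mul (x y : L0 k) :
  measurable_fun setT ((fun w => x w * y w) : T -> borel (scalar_field R k)).
Proof.
apply: (@measurable_comp2 k k k (fun z => z.1 * z.2)) => z.
by apply: cvgM; [exact: cvg_fst|exact: cvg_snd].
Qed.

Lemma measurable_L0_opp (x : L0 k) :
  measurable_fun setT ((fun w => - x w) : T -> borel (scalar_field R k)).
Proof.
apply: (@measurable_comp k k -%R); apply: epsilon_delta_continuous => u e e0.
by exists e => // v; rewrite -opprD normrN.
Qed.

Lemma measurable_L0_abs (x : L0 k) :
  measurable_fun setT
    ((fun w => modulus (x w)) : T -> borel (scalar_field R RealScalars)).
Proof.
exact: (@measurable_comp k RealScalars _ (@continuous_modulus R k)).
Qed.

Lemma measurable_L0_of_real (x : L0 RealScalars) :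
  measurable_fun setT
    ((fun w => of_real k (x w)) : T -> borel (scalar_field R k)).
Proof.
exact: (@measurable_comp RealScalars k _ (@continuous_of_real R k)).
Qed.

Lemma measurable_L0_min (x y : L0 RealScalars) :
  measurable_fun setT
    ((fun w => Num.min (x w : R) (y w)) :
      T -> borel (scalar_field R RealScalars)).
Proof.
exact: (@measurable_comp2 RealScalars RealScalars RealScalars
  (fun z : R * R => Num.min z.1 z.2) (@min_continuous _ R)).
Qed.

Lemma measurable_L0_indic (A : set T) : measurable A ->
  measurable_fun setT (\1_A : T -> borel (scalar_field R k)).
Proof.
move=> mA; apply: measurable_fun_borel => U oU.
rewrite preimage_indic.
by do 2 case: ifPn => _; do ?[exact: measurableC].
Qed.

Definition L0_zero : L0 k := L0_class (measurable_L0_cst 0).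
Definition L0_one : L0 k := L0_class (measurable_L0_cst 1).
Definition L0_add (x y : L0 k) : L0 k := L0_class (measurable_L0_add x y).
Definition L0_opp (x : L0 k) : L0 k := L0_class (measurable_L0_opp x).
Definition L0_mul (x y : L0 k) : L0 k := L0_class (measurable_L0_mul x y).

Lemma L0_zeroE : \forall w \ae P, L0_zero w = 0.
Proof. exact: L0_classE. Qed.
Lemma L0_oneE : \forall w \ae P, L0_one w = 1.
Proof. exact: L0_classE. Qed.
Lemma L0_addE x y : \forall w \ae P, L0_add x y w = x w + y w.
Proof. exact: L0_classE. Qed.
Lemma L0_oppE x : \forall w \ae P, L0_opp x w = - x w.
Proof. exact: L0_classE. Qed.
Lemma L0_mulE x y : \forall w \ae P, L0_mul x y w = x w * y w.
Proof. exact: L0_classE. Qed.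

Lemma L0_addA : associative L0_add.
Proof.
move=> x y z; apply: L0_eqP; near=> w.
rewrite (near (L0_addE x (L0_add y z)))// (near (L0_addE y z))//.
rewrite (near (L0_addE (L0_add x y) z))// (near (L0_addE x y))//.
exact: addrA.
Unshelve. all: by end_near. Qed.

Lemma L0_addC : commutative L0_add.
Proof.
move=> x y; apply: L0_eqP; near=> w.
rewrite (near (L0_addE x y))// (near (L0_addE y x))//.
exact: addrC.
Unshelve. all: by end_near. Qed.

Lemma L0_add0 : left_id L0_zero L0_add.
Proof.
move=> x; apply: L0_eqP; near=> w.
rewrite (near (L0_addE L0_zero x))// (near L0_zeroE)//.
exact: add0r.
Unshelve. all: by end_near. Qed.

Lemma L0_addN : left_inverse L0_zero L0_opp L0_add.
Proof.
move=> x; apply: L0_eqP; near=> w.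
rewrite (near (L0_addE (L0_opp x) x))// (near (L0_oppE x))// (near L0_zeroE)//.
exact: addNr.
Unshelve. all: by end_near. Qed.

Lemma L0_mulA : associative L0_mul.
Proof.
move=> x y z; apply: L0_eqP; near=> w.
rewrite (near (L0_mulE x (L0_mul y z)))// (near (L0_mulE y z))//.
rewrite (near (L0_mulE (L0_mul x y) z))// (near (L0_mulE x y))//.
exact: mulrA.
Unshelve. all: by end_near. Qed.

Lemma L0_mulC : commutative L0_mul.
Proof.
move=> x y; apply: L0_eqP; near=> w.
rewrite (near (L0_mulE x y))// (near (L0_mulE y x))//.
exact: mulrC.
Unshelve. all: by end_near. Qed.

Lemma L0_mul1 : left_id L0_one L0_mul.
Proof.
move=> x; apply: L0_eqP; near=> w.
rewrite (near (L0_mulE L0_one x))// (near L0_oneE)//.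
exact: mul1r.
Unshelve. all: by end_near. Qed.

Lemma L0_mulD : left_distributive L0_mul L0_add.
Proof.
move=> x y z; apply: L0_eqP; near=> w.
rewrite (near (L0_mulE (L0_add x y) z))// (near (L0_addE x y))//.
rewrite (near (L0_addE (L0_mul x z) (L0_mul y z)))//.
rewrite (near (L0_mulE x z))// (near (L0_mulE y z))//.
exact: mulrDl.
Unshelve. all: by end_near. Qed.

Lemma L0_one_neq0 : L0_one != L0_zero.
Proof.
apply/eqP => L10.
have : \forall w \ae P, False.
  have := L0_oneE; rewrite L10; move: L0_zeroE; apply: filterS2 => w -> /eqP.
  by rewrite eq_sym oner_eq0.
move=> [A [mA PA0 A1]].
have AT : A = setT by apply/seteqP; split => // w _; exact: A1.
by move: PA0; rewrite AT probability_setT => /eqP; rewrite onee_eq0.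
Qed.

End Lift.

HB.instance Definition _ k := GRing.isZmodule.Build (L0 k)
  (@L0_addA k) (@L0_addC k) (@L0_add0 k) (@L0_addN k).
HB.instance Definition _ k := GRing.Zmodule_isComNzRing.Build (L0 k)
  (@L0_mulA k) (@L0_mulC k) (@L0_mul1 k) (@L0_mulD k) (@L0_one_neq0 k).

Definition L0_le (x y : L0 RealScalars) : bool :=
  `[< \forall w \ae P, (x w : R) <= y w >].

Lemma L0_le_refl : reflexive L0_le.
Proof. by move=> x; apply/asboolP/aeW => w. Qed.

Lemma L0_le_anti : antisymmetric L0_le.
Proof.
move=> x y /andP[/asboolP xy /asboolP yx]; apply: L0_eqP.
by apply: filterS2 xy yx => w xy yx; apply/le_anti/andP.
Qed.

Lemma L0_le_trans : transitive L0_le.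
Proof.
move=> y x z /asboolP xy /asboolP yz; apply/asboolP.
by apply: filterS2 xy yz => w; exact: le_trans.
Qed.

(* Beware that x < y in this partial order only means x <= y and x != y;
   almost sure strict positivity is L0_pos. *)
HB.instance Definition _ :=
  Order.Le_isPOrder.Build ring_display (L0 RealScalars)
    L0_le_refl L0_le_anti L0_le_trans.

Definition L0_pos : set (L0 RealScalars) :=
  [set x | \forall w \ae P, 0 < (x w : R)].

Definition L0_abs k (x : L0 k) : L0 RealScalars :=
  L0_class (measurable_L0_abs x).

Definition L0_of_real k (x : L0 RealScalars) : L0 k :=
  L0_class (measurable_L0_of_real (k := k) x).

Definition L0_indic k (A : set T) (mA : measurable A) : L0 k :=
  L0_class (measurable_L0_indic (k := k) mA).

Definition L0_ball k (e : L0 RealScalars) : set (L0 k) :=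
  [set x | L0_abs x <= e].

(* The topology T_c. *)
Definition L0_open k : set_system (L0 k) :=
  [set V | forall y, V y ->
    exists2 e, L0_pos e & [set y + x | x in L0_ball e] `<=` V].

Lemma L0_openT k : @L0_open k setT.
Proof.
move=> y _; exists 1 => //.
by apply: filterS (L0_oneE RealScalars) => w ->.
Qed.

Lemma L0_openI k : setI_closed (@L0_open k).
Proof.
move=> V W oV oW y [/oV[e e0 eV] /oW[r r0 rW]].
pose m := L0_class (measurable_L0_min e r).
have mE : \forall w \ae P, m w = Num.min (e w : R) (r w) by exact: L0_classE.
have me : m <= e.
  by apply/asboolP; apply: filterS mE => w ->; rewrite ge_min lexx.
have mr : m <= r.
  by apply/asboolP; apply: filterS mE => w ->; rewrite ge_min lexx orbT.
exists m.
  apply: filterS3 mE e0 r0 => w -> ew rw.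
  by rewrite lt_min ew.
move=> _ [x xm <-]; split.
- by apply: eV; exists x => //; exact: le_trans me.
- by apply: rW; exists x => //; exact: le_trans mr.
Qed.

Lemma L0_open_bigcup k (I : Type) (f : I -> set (L0 k)) :
  (forall i, L0_open (f i)) -> L0_open (\bigcup_i f i).
Proof.
move=> fo y [i _ /fo[e e0 ef]]; exists e => //.
by move=> z /ef; exists i.
Qed.

HB.instance Definition _ k := isOpenTopological.Build (L0 k)
  (@L0_openT k) (@L0_openI k) (@L0_open_bigcup k).

End L0.
Arguments L0_of_real {d T R P} k x.
Arguments L0_indic {d T R P} k {A} mA.
Arguments L0_pos {d T R} P.

Record topology (E : Type) := Topology {
  is_open : set_system E ;
  is_openT : is_open setT ;
  is_openI : setI_closed is_open ;
  is_open_bigcup : forall (I : Type) (f : I -> set E),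
    (forall i, is_open (f i)) -> is_open (\bigcup_i f i)
}.

(* E with the topological structure given by tau. An alias is used because the
   library joins topologies and modules only over a numDomainType, which L0 is
   not. *)
Definition topologized (E : choiceType) (tau : topology E) : Type := E.

HB.instance Definition _ (E : choiceType) (tau : topology E) :=
  Choice.on (topologized tau).
HB.instance Definition _ (E : choiceType) (tau : topology E) :=
  isOpenTopological.Build (topologized tau)
    (is_openT tau) (@is_openI _ tau) (@is_open_bigcup _ tau).

Section L0Module.
Context d (T : measurableType d) (R : realType) (P : probability T R).
Context (k : scalar_kind) (E : lmodType (L0 P k)).
Implicit Types (tau : topology E) (U G : set E) (x : E).

Definition topological_L0_module tau :=
  continuous (fun z : topologized tau * topologized tau =>
    ((z.1 : E) + (z.2 : E)) : topologized tau) /\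
  continuous (fun z : L0 P k * topologized tau =>
    (z.1 *: (z.2 : E)) : topologized tau).

Definition neighborhood_base tau x (B : set (set E)) :=
  B `<=` nbhs (x : topologized tau) /\
  forall V, nbhs (x : topologized tau) V -> exists2 U, B U & U `<=` V.

Definition L0_convex U := forall (xi : L0 P RealScalars) x1 x2,
  0 <= xi -> xi <= 1 -> U x1 -> U x2 ->
  U (L0_of_real k xi *: x1 + L0_of_real k (1 - xi) *: x2).

Definition L0_absorbent U := forall x, exists2 xi, L0_pos P xi &
  [set L0_of_real k xi *: u | u in U] x.

Definition L0_balanced U := forall (xi : L0 P k) x,
  U x -> L0_abs xi <= 1 -> U (xi *: x).

Definition L0_seminorm (p : E -> L0 P RealScalars) :=
  [/\ forall x, 0 <= p x,
      forall (xi : L0 P k) x, p (xi *: x) = L0_abs xi * p x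
    & forall x1 x2, p (x1 + x2) <= p x1 + p x2].

Definition seminorm_ball (Q : set (E -> L0 P RealScalars))
    (e : L0 P RealScalars) : set E :=
  [set x | forall p, Q p -> p x <= e].

Definition induced_by tau (S : set (E -> L0 P RealScalars)) :=
  forall V : set E, is_open tau V <->
    forall y, V y -> exists Q e,
      [/\ finite_set Q, Q `<=` S, L0_pos P e
        & [set y + x | x in seminorm_ball Q e] `<=` V].

(* The set denoted by the formal sum of the I_(A n) x_n; it may have several
   elements. *)
Definition concatenations (A : nat -> set T) (mA : forall n, measurable (A n))
    (x : nat -> E) : set E :=
  [set z | forall n, L0_indic k (mA n) *: z = L0_indic k (mA n) *: x n].

Definition countably_concatenated (A : nat -> set T)
    (mA : forall n, measurable (A n)) (x : nat -> E) :=
  concatenations mA x !=set0.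

Definition relative_countable_concatenation G :=
  forall (x : nat -> E) (A : nat -> set T) (mA : forall n, measurable (A n)),
    (forall n, G (x n)) -> trivIset setT A -> \bigcup_n A n = setT ->
    countably_concatenated mA x -> concatenations mA x `<=` G.

End L0Module.

(* Main.v *)
Require Import Defs.
From HB Require Import structures.
From mathcomp Require Import all_boot all_order all_algebra.
From mathcomp Require Import complex.
From mathcomp Require Import all_classical all_reals all_analysis.
From mathcomp Require Import measurable_realfun.
Set Implicit Arguments.
Unset Strict Implicit.
Unset Printing Implicit Defensive.
Import Order.TTheory GRing.Theory Num.Theory.
Import numFieldNormedType.Exports.
Local Open Scope classical_set_scope.
Local Open Scope ring_scope.

(** From seminorms to a base: the balls of finitely many seminorms are a base
    of neighborhoods of 0 by the definition of the induced topology, as soon as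
    each ball is a neighborhood of 0 ([seminorm_ball_nbhs], by halving radii).
    A ball is closed under concatenation because p (1_A x) = 1_A p x: an almost
    sure bound that holds on each of countably many pieces of Omega holds on
    Omega.

    From a base to seminorms: each U in the base has a gauge, the essential
    infimum p x of the random a >= 0 with x in a U.  As in the classical case,
    convexity makes p subadditive and balancedness makes it homogeneous; since
    scalars may vanish on part of Omega, the argument uses the pointwise inverse
    with the value 0 at 0, so that z / z is the indicator of the support of z.
    The gauge induces the topology because U contains all x with p x < 1 almost
    surely and e U lies in the p-ball of radius e.  The second inclusion holds
    because e is one of the a over which the infimum is taken.  The first needs
    the concatenation property: an essential infimum is the infimum of a
    sequence s n with x in s n U ([essential_infimum]), so Omega is covered,
    up to a null set, by the events s n < 1.  On such an event x agrees with
    an element of U, and U is closed under gluing these elements along a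
    countable partition ([gauge_lt1]).

    The remaining step is topological: multiplication by the invertible scalar
    e is a homeomorphism, so e U is a neighborhood of 0, and translations carry
    the comparison at 0 to every point ([induced_by_gauges]). *)

(** * The scalar field *)

Section ScalarField.
Context (R : realType) (k : scalar_kind).
Implicit Types (a b : R) (x y : scalar_field R k).

Lemma of_real0 : of_real k 0 = 0 :> scalar_field R k.
Proof. by case: k. Qed.

Lemma of_real1 : of_real k 1 = 1 :> scalar_field R k.
Proof. by case: k. Qed.

Lemma of_realM a b : of_real k (a * b) = of_real k a * of_real k b.
Proof. by case: k => //=; rewrite rmorphM. Qed.

Lemma of_real_inj : injective (of_real k : R -> scalar_field R k).
Proof. by case: k => //= a b []. Qed.

Lemma modulus_ge0 x : 0 <= modulus x.
Proof. by rewrite -(of_real_le k) of_real0 -norm_scalar. Qed.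

Lemma modulusM x y : modulus (x * y) = modulus x * modulus y.
Proof. by apply: of_real_inj; rewrite of_realM -!norm_scalar normrM. Qed.

Lemma modulus_eq0 x : (modulus x == 0) = (x == 0).
Proof.
by rewrite -[RHS]normr_eq0 norm_scalar -of_real0 (inj_eq of_real_inj).
Qed.

Lemma modulus0 : modulus (0 : scalar_field R k) = 0.
Proof. by apply/eqP; rewrite modulus_eq0. Qed.

Lemma modulus1 : modulus (1 : scalar_field R k) = 1.
Proof. by rewrite -of_real1 modulus_of_real normr1. Qed.

Lemma modulusV x : modulus x^-1 = (modulus x)^-1.
Proof.
have [->|x0] := eqVneq x 0; first by rewrite invr0 modulus0 invr0.
apply: (@mulIf _ (modulus x)); first by rewrite modulus_eq0.
by rewrite -modulusM !mulVf ?modulus1 ?modulus_eq0.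
Qed.

End ScalarField.

(** * Random scalars *)

Section RandomScalars.
Context d (T : measurableType d) (R : realType) (P : probability T R).
Implicit Types (k : scalar_kind).

(** Inversion is discontinuous only at 0, and the singleton of 0 is a Borel
    set, so the two parts of a preimage are measurable separately. *)
Lemma measurable_L0_inv k (x : L0 P k) :
  measurable_fun setT ((fun w => (x w)^-1) : T -> borel (scalar_field R k)).
Proof.
pose F := scalar_field R k.
apply: measurable_fun_borel => U oU.
pose Z : set F := [set y | y != 0].
have oZ : open Z.
  rewrite (_ : Z = ~` [set 0]); last first.
    by apply/seteqP; split=> y /= => [/eqP|yZ]; [|exact/eqP].
  apply: closed_openC; apply: accessible_closed_set1.
  exact/hausdorff_accessible/norm_hausdorff.
have mZ : measurable (Z : set (borel F)).
  exact: open_measurable_borel.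
rewrite -[_ @^-1` _](_ : x @^-1` ((Z `&` GRing.inv @^-1` U) `|`
    (~` Z `&` GRing.inv @^-1` U)) = _); last first.
  by rewrite -setIUl setUv setTI.
rewrite -[_ @^-1` _]setTI; apply: L0_measurable => //.
apply: measurableU.
  apply: open_measurable_borel; rewrite openE => y [/= y0 Uy].
  rewrite /interior; apply: filterI.
    by apply: open_nbhs_nbhs; split.
  by apply: (inv_continuous y0); exact: open_nbhs_nbhs.
have [U0|U0] := pselect (U 0).
  rewrite (_ : _ `&` _ = ~` Z); first exact: measurableC.
  apply/seteqP; split => [y []//|y Zy]; split=> //.
  by move/negP: Zy; rewrite negbK => /eqP -> /=; rewrite invr0.
rewrite (_ : _ `&` _ = set0); first exact: measurable0.
apply/seteqP; split => // y [/negP]; rewrite negbK => /eqP -> /=.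
by rewrite invr0.
Qed.

Definition L0_inv k (x : L0 P k) : L0 P k := L0_class P (measurable_L0_inv x).

(** A class for instance search: the instances below compute, from the shape of
    a random scalar, a pointwise formula for it, which reduces (in)equalities
    between random scalars to scalar ones. *)
Class represents k (x : L0 P k) (f : T -> scalar_field R k) : Prop :=
  represents_ae : \forall w \ae P, x w = f w.

#[export] Instance represents_self k (x : L0 P k) : represents x x | 100.
Proof. exact: aeW. Qed.

#[export] Instance represents0 k : represents (0 : L0 P k) (fun=> 0) | 1.
Proof. exact: L0_zeroE. Qed.

#[export] Instance represents1 k : represents (1 : L0 P k) (fun=> 1) | 1.
Proof. exact: L0_oneE. Qed.

#[export] Instance representsD k (x y : L0 P k) f g :
  represents x f -> represents y g ->
  represents (x + y) (fun w => f w + g w) | 1.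
Proof.
move=> xf yg; apply: filterS3 xf yg (L0_addE x y) => w <- <-; exact.
Qed.

#[export] Instance representsN k (x : L0 P k) f :
  represents x f -> represents (- x) (fun w => - f w) | 1.
Proof. by move=> xf; apply: filterS2 xf (L0_oppE x) => w <-; exact. Qed.

#[export] Instance representsM k (x y : L0 P k) f g :
  represents x f -> represents y g ->
  represents (x * y) (fun w => f w * g w) | 1.
Proof.
move=> xf yg; apply: filterS3 xf yg (L0_mulE x y) => w <- <-; exact.
Qed.

#[export] Instance representsV k (x : L0 P k) f :
  represents x f -> represents (L0_inv x) (fun w => (f w)^-1) | 1.
Proof. by apply: filterS2 (L0_classE P (measurable_L0_inv x)) => w -> ->. Qed.

#[export] Instance represents_abs k (x : L0 P k) f :
  represents x f ->
  represents (L0_abs x)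
    (fun w => modulus (f w) : scalar_field R RealScalars) | 1.
Proof. by apply: filterS2 (L0_classE P (measurable_L0_abs x)) => w -> ->. Qed.

#[export] Instance represents_of_real k (x : L0 P RealScalars) f :
  represents x f ->
  represents (L0_of_real k x) (fun w => of_real k (f w : R)) | 1.
Proof.
by apply: filterS2 (L0_classE P (measurable_L0_of_real (k := k) x)) => w -> ->.
Qed.

#[export] Instance represents_indic k (A : set T) (mA : measurable A) :
  represents (L0_indic k mA : L0 P k) \1_A | 1.
Proof. exact: L0_classE. Qed.

Lemma L0_eq_ae k (x y : L0 P k) f g
    {xf : represents x f} {yg : represents y g} :
  (\forall w \ae P, f w = g w) -> x = y.
Proof.
move=> fg; apply: L0_eqP.
by apply: filterS3 xf yg fg => w -> ->.
Qed.

Lemma L0_le_ae (x y : L0 P RealScalars) f g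
    {xf : represents x f} {yg : represents y g} :
  (\forall w \ae P, (f w : R) <= g w) -> x <= y.
Proof.
move=> fg; apply/asboolP.
by apply: filterS3 xf yg fg => w -> ->.
Qed.

Lemma L0_eqE k (x y : L0 P k) f g
    {xf : represents x f} {yg : represents y g} :
  x = y -> \forall w \ae P, f w = g w.
Proof. by move=> xy; apply: filterS2 xf yg => w; rewrite xy => -> ->. Qed.

Lemma L0_leE (x y : L0 P RealScalars) f g
    {xf : represents x f} {yg : represents y g} :
  x <= y -> \forall w \ae P, (f w : R) <= g w.
Proof. by move=> /asboolP; apply: filterS3 xf yg => w -> ->. Qed.

Lemma L0_pos_ae (x : L0 P RealScalars) f {xf : represents x f} :
  (\forall w \ae P, 0 < (f w : R)) -> L0_pos P x.
Proof. by apply: filterS2 xf => w ->. Qed.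

Lemma L0_ge0 (x : L0 P RealScalars) : 0 <= x -> \forall w \ae P, 0 <= (x w : R).
Proof. exact: L0_leE. Qed.

Lemma L0_pos_ge0 (x : L0 P RealScalars) : L0_pos P x -> 0 <= x.
Proof. by move=> x0; apply: L0_le_ae; apply: filterS x0 => w /ltW. Qed.

Lemma L0_lerD (a b c e : L0 P RealScalars) : a <= b -> c <= e -> a + c <= b + e.
Proof.
move=> /L0_leE ab /L0_leE ce; apply: L0_le_ae.
by apply: filterS2 ab ce => w; exact: (@lerD R).
Qed.

Lemma L0_ler_wpM2l (a b c : L0 P RealScalars) :
  0 <= a -> b <= c -> a * b <= a * c.
Proof.
move=> /L0_leE a0 /L0_leE bc; apply: L0_le_ae.
apply: filterS2 a0 bc => w a0 bc; exact: (@ler_wpM2l R _ a0 _ _ bc).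
Qed.

Lemma L0_mulr_ge0 (a b : L0 P RealScalars) : 0 <= a -> 0 <= b -> 0 <= a * b.
Proof. by move=> a0 /(L0_ler_wpM2l a0); rewrite mulr0. Qed.

Lemma L0_addr_ge0 (a b : L0 P RealScalars) : 0 <= a -> 0 <= b -> 0 <= a + b.
Proof. by move=> a0 /(L0_lerD a0); rewrite addr0. Qed.

Lemma L0_subr_ge0 (a b : L0 P RealScalars) : a <= b -> 0 <= b - a.
Proof. by move=> /L0_lerD /(_ (lexx (- a))); rewrite subrr. Qed.

Lemma L0_invr_ge0 (a : L0 P RealScalars) : 0 <= a -> 0 <= L0_inv a.
Proof.
move=> /L0_leE a0; apply: L0_le_ae.
by apply: filterS a0 => w; rewrite invr_ge0.
Qed.

Lemma L0_mulfV (a : L0 P RealScalars) : L0_pos P a -> a * L0_inv a = 1.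
Proof.
by move=> a0; apply: L0_eq_ae; apply: filterS a0 => w /lt0r_neq0; exact: mulfV.
Qed.

Lemma L0_pos_inv (a : L0 P RealScalars) : L0_pos P a -> L0_pos P (L0_inv a).
Proof.
by move=> a0; apply: L0_pos_ae; apply: filterS a0 => w; rewrite invr_gt0.
Qed.

Lemma L0_pos1 : L0_pos P 1.
Proof. by apply: L0_pos_ae; apply: aeW => w; exact: ltr01. Qed.

Lemma L0_posDl (a b : L0 P RealScalars) :
  0 <= a -> L0_pos P b -> L0_pos P (a + b).
Proof.
move=> /L0_leE a0 b0; apply: L0_pos_ae.
by apply: filterS2 a0 b0 => w; exact: (@ltr_wpDl R).
Qed.

Lemma L0_half_exists (e : L0 P RealScalars) : L0_pos P e ->
  exists2 h, L0_pos P h & h + h = e.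
Proof.
move=> e0; exists (L0_inv (1 + 1) * e).
  apply: L0_pos_ae; apply: filterS e0 => w e0.
  by rewrite mulr_gt0 // invr_gt0.
apply: L0_eq_ae; apply: aeW => w.
by rewrite -mulrDl -[_ + _^-1]mulr2n -mulr_natr mulVf ?mul1r ?pnatr_eq0.
Qed.

Section Modulus.
Context (k : scalar_kind).
Implicit Types (a b : L0 P RealScalars) (x y : L0 P k).

Lemma L0_abs_ge0 x : 0 <= L0_abs x.
Proof. by apply: L0_le_ae; apply: aeW => w; exact: modulus_ge0. Qed.

Lemma L0_absM x y : L0_abs (x * y) = L0_abs x * L0_abs y.
Proof. by apply: L0_eq_ae; apply: aeW => w; exact: modulusM. Qed.

Lemma L0_abs0 : L0_abs (0 : L0 P k) = 0.
Proof. by apply: L0_eq_ae; apply: aeW => w; exact: modulus0. Qed.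

Lemma L0_abs_of_real a : 0 <= a -> L0_abs (L0_of_real k a) = a.
Proof.
move=> /L0_leE a0; apply: L0_eq_ae; apply: filterS a0 => w a0.
by rewrite modulus_of_real ger0_norm.
Qed.

Lemma L0_abs_indic (A : set T) (mA : measurable A) :
  L0_abs (L0_indic k mA : L0 P k) = L0_indic RealScalars mA.
Proof.
apply: L0_eq_ae; apply: aeW => w; rewrite !indicE.
by case: (w \in A); rewrite ?modulus0 ?modulus1.
Qed.

Lemma L0_indic_ge0 (A : set T) (mA : measurable A) :
  0 <= (L0_indic RealScalars mA : L0 P RealScalars).
Proof. by rewrite -L0_abs_indic L0_abs_ge0. Qed.

Lemma L0_of_real1 : L0_of_real k 1 = 1 :> L0 P k.
Proof. by apply: L0_eq_ae; apply: aeW => w; exact: of_real1. Qed.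

Lemma L0_of_realM a b : L0_of_real k (a * b) = L0_of_real k a * L0_of_real k b.
Proof. by apply: L0_eq_ae; apply: aeW => w; exact: of_realM. Qed.

(** Division by a random scalar that may vanish: the bound on x forces x to
    vanish wherever a does. *)
Lemma L0_divfK x a : L0_abs x <= a ->
  L0_of_real k a * (x * L0_inv (L0_of_real k a)) = x.
Proof.
move=> /L0_leE xa; apply: L0_eq_ae; apply: filterS xa => w xa.
have [a0|a0] := eqVneq (a w : R) 0; last first.
  by rewrite mulrCA mulfV ?mulr1// -(of_real0 R) (inj_eq (@of_real_inj _ _)).
rewrite a0 of_real0 mul0r; apply/esym/eqP.
by move: xa; rewrite a0 -modulus_eq0 eq_le modulus_ge0 andbT.
Qed.

Lemma L0_abs_div_le1 x a : L0_abs x <= a ->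
  L0_abs (x * L0_inv (L0_of_real k a)) <= 1.
Proof.
move=> /L0_leE xa; apply: L0_le_ae; apply: filterS xa => w xa.
have a0 : 0 <= (a w : R) by apply: le_trans xa; exact: modulus_ge0.
rewrite modulusM modulusV modulus_of_real ger0_norm//.
have [->|an0] := eqVneq (a w : R) 0; first by rewrite invr0 mulr0.
by rewrite ler_pdivrMr ?mul1r// lt_neqAle eq_sym an0.
Qed.

End Modulus.

Lemma L0_lerBlDr (a b c : L0 P RealScalars) : (a - b <= c) = (a <= c + b).
Proof.
apply/idP/idP => /L0_lerD.
- by move=> /(_ _ _ (lexx b)); rewrite subrK.
- by move=> /(_ _ _ (lexx (- b))); rewrite addrK.
Qed.

Lemma L0_ge0_abs (a : L0 P RealScalars) : 0 <= a -> L0_abs a = a.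
Proof.
by move=> /L0_leE a0; apply: L0_eq_ae; apply: filterS a0 => w /ger0_norm.
Qed.

Lemma L0_of_real_id (a : L0 P RealScalars) : L0_of_real RealScalars a = a.
Proof. by apply: L0_eq_ae; exact: aeW. Qed.

(** Again a may vanish, and the bound makes b vanish there too. *)
Lemma L0_mulVK (a b c : L0 P RealScalars) :
  0 <= b -> b <= a * c -> a * (L0_inv a * b) = b.
Proof.
move=> /L0_leE b0 /L0_leE bac; apply: L0_eq_ae.
apply: filterS2 b0 bac => w b0 bac.
have [a0|a0] := eqVneq (a w : R) 0; last exact: (mulVKf a0).
rewrite a0 mul0r; apply/eqP; rewrite eq_le b0 /=.
by move: bac; rewrite a0 mul0r.
Qed.

Lemma L0_mulV_le1 k (x : L0 P k) : L0_abs (x * L0_inv x) <= 1.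
Proof.
apply: L0_le_ae; apply: aeW => w.
have [->|x0] := eqVneq (x w) 0; first by rewrite mul0r modulus0.
by rewrite mulfV// modulus1.
Qed.

Lemma L0_mul_subV k (x : L0 P k) : x * (1 - L0_inv x * x) = 0.
Proof.
apply: L0_eq_ae; apply: aeW => w.
have [->|x0] := eqVneq (x w) 0; first by rewrite mul0r.
by rewrite mulVf// subrr mulr0.
Qed.

Lemma ae_bigcup (A : nat -> set T) (Q : T -> Prop) : \bigcup_n A n = setT ->
  (forall n, \forall w \ae P, A n w -> Q w) -> \forall w \ae P, Q w.
Proof.
move=> AT /ae_foralln; apply: filterS => w AQ.
by have [n _ /AQ] : (\bigcup_n A n) w by rewrite AT.
Qed.

End RandomScalars.

(** * Essential infima *)

Section EssentialInfimum.
Context d (T : measurableType d) (R : realType) (P : probability T R).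

(** A maximizing sequence argument: the measure of a countable union of members
    of F has a supremum, and it is attained, because countably many countable
    unions form one.  A member with mass outside a maximal union would enlarge
    it. *)
Lemma countable_exhaustion (F : set (set T)) : F !=set0 ->
  (forall A, F A -> measurable A) ->
  exists A : nat -> set T, (forall n, F (A n)) /\
    forall B, F B -> P (B `\` \bigcup_n A n) = 0%E.
Proof.
move=> [A0 FA0] mF.
have mU (A : nat -> set T) : (forall n, F (A n)) -> measurable (\bigcup_n A n).
  by move=> FA; apply: bigcupT_measurable => n; exact/mF.
pose S := [set c : R | exists2 A : nat -> set T,
  forall n, F (A n) & c = fine (P (\bigcup_n A n))].
have S_sup : has_sup S.
  split; first by exists (fine (P (\bigcup_(n : nat) A0))), (fun=> A0).
  exists 1 => _ [A FA ->].
  rewrite -lee_fin fineK ?fin_num_measure//; last exact: mU.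
  exact: probability_le1 (mU _ FA).
have /choice[A_ A_P] (n : nat) : exists A : nat -> set T, (forall m, F (A m)) /\
    sup S - n.+1%:R^-1 < fine (P (\bigcup_m A m)).
  have n0 : 0 < n.+1%:R^-1 :> R by rewrite invr_gt0.
  by have [_ [A FA ->] ?] := sup_adherent n0 S_sup; exists A.
pose A n := if unpickle n is Some (i, j) then A_ i j else A0.
have FA n : F (A n).
  by rewrite /A; case: unpickle => [[i j]|//]; have [] := A_P i.
have supA : sup S <= fine (P (\bigcup_n A n)).
  apply/ler_addgt0Pr => e e0.
  have [n ne] : exists n, (n.+1%:R^-1 : R) < e.
    exists (Num.truncn e^-1).
    by rewrite invf_plt ?posrE// truncnS_gt.
  have [FAn /ltW supn] := A_P n.
  rewrite -lerBlDr; apply: le_trans (le_trans supn _).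
    by rewrite lerD2l lerN2 ltW.
  have [mA_ mA] := (mU _ FAn, mU _ FA).
  apply: fine_le; rewrite ?fin_num_measure//.
  apply: le_measure; rewrite ?inE//.
  move=> w [m _ nm]; exists (pickle (n, m)) => //.
  by rewrite /A pickleK.
exists A; split=> // B FB.
have mB := mF _ FB; have mA := mU _ FA.
have mD : measurable (B `\` \bigcup_n A n) by exact: measurableD.
have SB : S (fine (P (B `|` \bigcup_n A n))).
  exists (fun n => if n is m.+1 then A m else B); first by case.
  congr (fine (P _)); apply/seteqP; split=> [w [Bw|[n _ Anw]]|w [[|n] _ /= ?]].
  - by exists 0%N.
  - by exists n.+1.
  - by left.
  - by right; exists n.
have := le_trans (sup_upper_bound S_sup SB) supA.
(* P (B `|` U) <= sup S <= P U, for U the maximal union. *)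
rewrite -(@setDUK _ (\bigcup_n A n) (B `|` \bigcup_n A n)); last first.
  exact: subsetUr.
rewrite setDUl setDv setU0 measureU//; last first.
  by rewrite setDE setICA setICr setI0.
rewrite fineD ?fin_num_measure// gerDl => le0.
apply/eqP; rewrite -[P _]fineK ?fin_num_measure// eqe eq_le le0/=.
exact: fine_ge0.
Qed.

(** The Borel sigma-algebra generated by the open sets is the standard one on
    the reals, which is generated by half-open intervals. *)
Lemma measurable_fun_borelP (f : T -> R) :
  measurable_fun setT (f : T -> borel R) <-> measurable_fun setT f.
Proof.
split=> mf; last first.
  apply: measurable_fun_borel => U oU; rewrite -[_ @^-1` _]setTI.
  by apply: mf => //; exact: open_measurable.
apply: (measurability _ (RGenOpens.measurableE R)) => _ [_ [a [b ->]] <-].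
by apply: mf => //; apply: open_measurable_borel; exact: itv_open.
Qed.

Lemma L0_measurable_real (x : L0 P RealScalars) :
  measurable_fun setT (x : T -> R).
Proof.
by apply/measurable_fun_borelP; exact: (L0_measurable (k := RealScalars)).
Qed.

(** For each rational q, countably many members of G exhaust the events x < q
    with x in G.  The pointwise infimum of all these members is the essential
    infimum: if x < g had positive probability, so would x < q < g for some
    rational q, against the exhaustion.  That the infimum is approached along a
    sequence is what countable concatenation can later exploit. *)
Lemma essential_infimum (G : set (L0 P RealScalars)) : G !=set0 ->
  (forall x, G x -> 0 <= x) ->
  exists g : L0 P RealScalars, [/\ forall x, G x -> g <= x,
      forall h : L0 P RealScalars, (forall x, G x -> h <= x) -> h <= g
    & exists2 s : nat -> L0 P RealScalars, forall n, G (s n) &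
      \forall w \ae P,
        forall c : R, (g w : R) < c -> exists n, (s n w : R) < c].
Proof.
move=> [x0 Gx0] G0.
pose D (q : rat) (x : L0 P RealScalars) := [set w | (x w : R) < ratr q].
have mD q x : measurable (D q x).
  rewrite [D q x](_ : _ = x @^-1` `]-oo, ratr q[%classic).
    by rewrite -[_ @^-1` _]setTI; exact: L0_measurable_real.
  by apply/seteqP; split=> w /=; rewrite in_itv.
have /choice[t tP] (q : rat) : exists t : nat -> L0 P RealScalars,
    (forall n, G (t n)) /\
    forall x, G x -> P (D q x `\` \bigcup_n D q (t n)) = 0%E.
  have [|_ [x _ <-] //|A [DA PA]] := @countable_exhaustion (D q @` G).
    by exists (D q x0), x0.
  have /choice[t tP] n : exists x, G x /\ D q x = A n.
    by have [x Gx <-] := DA n; exists x.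
  exists t; split=> [n|x Gx]; first by have [] := tP n.
  rewrite (eq_bigcupr (fun n _ => (tP n).2)).
  by apply: PA; exists x.
pose s n := if unpickle n is Some (q, m) then t q m else x0.
have Gs n : G (s n).
  by rewrite /s; case: unpickle => [[q m]|//]; have [] := tP q.
have s0 : \forall w \ae P, forall n, 0 <= (s n w : R).
  by apply/ae_foralln => n; exact/L0_ge0/G0.
(* The absolute values bound the sequence from below at every w, not only
   almost everywhere; almost surely they change nothing. *)
pose gf w := inf (range (fun n => `|s n w : R|)).
have gf_lb w : has_lbound (range (fun n => `|s n w : R|)).
  by exists 0 => _ [n _ <-].
have mgf : measurable_fun setT (gf : T -> borel (scalar_field R RealScalars)).
  apply/measurable_fun_borelP.
  rewrite [gf](_ : _ = fun w => infs (fun n => `|s n w : R|) 0); last first.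
    apply/funext => w; rewrite /gf /infs /sdrop; congr inf.
    by apply/seteqP; split=> _ [n _ <-]; exists n.
  apply: (measurable_fun_infs (h := fun n w => `|s n w : R|)) => //.
  move=> n; apply: (measurableT_comp (@normr_measurable R setT)).
  exact: L0_measurable_real.
have [g gE] : exists g : L0 P RealScalars, \forall w \ae P, (g w : R) = gf w.
  by exists (L0_class P mgf); exact: (L0_classE P mgf).
have gs : \forall w \ae P, forall n, (g w : R) <= s n w.
  apply: filterS2 gE s0 => w -> sw n.
  by rewrite -[leRHS]ger0_norm//; apply: ge_inf => //; exists n.
have sg : \forall w \ae P, forall c : R, (g w : R) < c ->
    exists n, (s n w : R) < c.
  apply: filterS2 gE s0 => w -> sw c.
  move=> /(inf_lt _)[|_ [n _ <-]]; first by exists `|s 0 w|, 0%N.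
  by rewrite ger0_norm//; exists n.
exists g; split.
- move=> x Gx; apply: L0_le_ae.
  have : \forall w \ae P, forall n,
      if unpickle n is Some q
      then ~ (D q x `\` \bigcup_n D q (t q n)) w else True.
    apply/ae_foralln => n; case: unpickle => [q|]; last exact: aeW.
    exists (D q x `\` \bigcup_n D q (t q n)); split.
    - by apply: measurableD => //; exact: bigcupT_measurable.
    - by have [_] := tP q; exact.
    - by move=> w /= /contrapT.
  apply: filterS2 gs => w gs xw; rewrite leNgt; apply/negP => xg.
  have [q] := rat_in_itvoo xg; rewrite in_itv/= => /andP[xq qg].
  have := xw (pickle q); rewrite pickleK; apply; split=> // -[n _].
  rewrite /D/=; apply/negP; rewrite -leNgt; apply: le_trans (ltW qg) _.
  by have := gs (pickle (q, n)); rewrite /s pickleK.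
- move=> h hG; apply: L0_le_ae.
  have hs : \forall w \ae P, forall n, (h w : R) <= s n w.
    apply/ae_foralln => n; exact: (L0_leE (hG _ (Gs n))).
  apply: filterS2 sg hs => w sg hs; rewrite leNgt; apply/negP => hg.
  by have [n] := sg _ hg; apply/negP; rewrite -leNgt.
- by exists s.
Qed.

End EssentialInfimum.

(** * Balls of seminorms *)

Lemma finite_set_ind T (Q : set T -> Prop) : Q set0 ->
  (forall x A, Q A -> Q (x |` A)) -> forall A, finite_set A -> Q A.
Proof.
move=> Q0 QU A /finite_setP[n]; elim: n A => [A|n IH A].
  by rewrite II0 card_eq0 => /eqP ->.
by move=> /eq_cardSP[x Ax /IH QA]; rewrite -(setD1K Ax); exact: QU.
Qed.

Section Seminorms.
Context d (T : measurableType d) (R : realType) (P : probability T R).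
Context (k : scalar_kind) (E : lmodType (L0 P k)).
Implicit Types (p : E -> L0 P RealScalars) (Q S : set (E -> L0 P RealScalars)).

Lemma L0_seminorm0 p : L0_seminorm p -> p 0 = 0.
Proof.
by case=> _ pZ _; rewrite -(scale0r (0 : E)) pZ L0_abs0 mul0r.
Qed.

Lemma seminorm_bound Q x : finite_set Q -> (forall p, Q p -> 0 <= p x) ->
  exists2 m, 0 <= m & forall p, Q p -> p x <= m.
Proof.
move: Q; apply: finite_set_ind => [_|p A IH A0].
  by exists 0 => // p [].
have [q Aq|m m0 mA] := IH; first by apply: A0; right.
have p0 : 0 <= p x by apply: A0; left.
exists (p x + m); first exact: L0_addr_ge0.
move=> q [->|Aq]; first by rewrite -[leLHS]addr0; exact: L0_lerD.
by rewrite -[leLHS]add0r; apply: L0_lerD => //; exact: mA.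
Qed.

Lemma seminorm_ballD Q a b x y : (forall p, Q p -> L0_seminorm p) ->
  seminorm_ball Q a x -> seminorm_ball Q b y -> seminorm_ball Q (a + b) (x + y).
Proof.
move=> Qs xa yb p Qp; have [_ _ pD] := Qs p Qp.
by apply: le_trans (pD x y) _; apply: L0_lerD; [exact: xa|exact: yb].
Qed.

Section Ball.
Variables (Q : set (E -> L0 P RealScalars)) (e : L0 P RealScalars).
Hypotheses (Qs : forall p, Q p -> L0_seminorm p) (e0 : L0_pos P e).

Lemma seminorm_ball0 : seminorm_ball Q e 0.
Proof. by move=> p /Qs /L0_seminorm0 ->; exact: L0_pos_ge0. Qed.

Lemma seminorm_ball_convex : L0_convex (seminorm_ball Q e).
Proof.
move=> xi x y xi0 xi1 xe ye p Qp; have [p0 pZ pD] := Qs Qp.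
apply: le_trans (pD _ _) _.
rewrite !pZ !L0_abs_of_real//; last exact: L0_subr_ge0.
rewrite (_ : e = xi * e + (1 - xi) * e); last first.
  by rewrite -mulrDl addrC subrK mul1r.
apply: L0_lerD; apply: L0_ler_wpM2l => //.
- exact: xe.
- exact: L0_subr_ge0.
- exact: ye.
Qed.

Lemma seminorm_ball_balanced : L0_balanced (seminorm_ball Q e).
Proof.
move=> xi x xe xi1 p Qp; have [p0 pZ _] := Qs Qp; rewrite pZ.
apply: le_trans (xe _ Qp).
by rewrite -[leRHS]mulr1 mulrC; exact: L0_ler_wpM2l.
Qed.

(** With m a common bound of the p x, the scalar xi = m / e + 1 is invertible
    and satisfies m <= xi e. *)
Lemma seminorm_ball_absorbent :
  finite_set Q -> L0_absorbent (seminorm_ball Q e).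
Proof.
move=> finQ x.
have [p Qp|m m0 mQ] := @seminorm_bound Q x finQ; first by have [] := Qs Qp.
pose xi := L0_inv e * m + 1.
have xi0 : L0_pos P xi.
  apply: L0_posDl; last exact: L0_pos1.
  by apply/L0_mulr_ge0/m0/L0_pos_ge0/L0_pos_inv.
have ixi0 : 0 <= L0_inv xi by apply/L0_pos_ge0/L0_pos_inv.
exists xi => //; exists (L0_of_real k (L0_inv xi) *: x); last first.
  by rewrite scalerA -L0_of_realM L0_mulfV// L0_of_real1 scale1r.
move=> p Qp; have [p0 pZ _] := Qs Qp; rewrite pZ L0_abs_of_real//.
have mxi : m <= xi * e.
  rewrite mulrDl mul1r mulrAC [L0_inv e * e]mulrC L0_mulfV// mul1r.
  by rewrite -[leLHS]addr0; apply: L0_lerD => //; exact: L0_pos_ge0.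
apply: le_trans (L0_ler_wpM2l ixi0 (le_trans (mQ _ Qp) mxi)) _.
by rewrite mulrA [L0_inv xi * xi]mulrC L0_mulfV// mul1r.
Qed.

(** On the piece A n, p z = p (1_(A n) z) = p (1_(A n) x_n) is at most e. *)
Lemma seminorm_ball_concatenation :
  relative_countable_concatenation (seminorm_ball Q e).
Proof.
move=> x A mA xe _ AT _ z zx p Qp; have [p0 pZ _] := Qs Qp.
apply: L0_le_ae; apply: ae_bigcup AT _ => n.
have : L0_indic RealScalars (mA n) * p z <= L0_indic RealScalars (mA n) * e.
  rewrite -(L0_abs_indic P k) -pZ zx pZ L0_abs_indic.
  by apply: L0_ler_wpM2l; [exact: L0_indic_ge0|exact: xe].
move=> /L0_leE; apply: filterS => w + Aw.
by rewrite indicE mem_set// !mul1r.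
Qed.

End Ball.
End Seminorms.

(** * Gauges *)

Section Gauge.
Context d (T : measurableType d) (R : realType) (P : probability T R).
Context (k : scalar_kind) (E : lmodType (L0 P k)) (U : set E).
Hypotheses (Uc : L0_convex U) (Ua : L0_absorbent U) (Ub : L0_balanced U).
Implicit Types (a b : L0 P RealScalars) (x y u : E) (z : L0 P k).

Definition gauge_set x : set (L0 P RealScalars) :=
  [set a | 0 <= a /\ exists2 u, U u & x = L0_of_real k a *: u].

Lemma balanced0 : U 0.
Proof.
have [a _ [u Uu _]] := Ua 0; rewrite -(scale0r u); apply: Ub => //.
by rewrite L0_abs0; exact/L0_pos_ge0/L0_pos1.
Qed.

Lemma gauge_set_neq0 x : gauge_set x !=set0.
Proof.
by have [a /L0_pos_ge0 a0 [u Uu <-]] := Ua x; exists a; split=> //; exists u.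
Qed.

(** The scalar only has to be dominated by a: balancedness absorbs the quotient
    z / a, so that no measurable choice of a phase for z is needed. *)
Lemma gauge_set_abs z u a : U u -> L0_abs z <= a -> gauge_set (z *: u) a.
Proof.
move=> Uu za; split; first by apply: le_trans za; exact: L0_abs_ge0.
exists ((z * L0_inv (L0_of_real k a)) *: u).
  by apply: Ub => //; exact: L0_abs_div_le1.
by rewrite scalerA L0_divfK.
Qed.

Lemma gauge_setZ z x a : gauge_set x a -> gauge_set (z *: x) (L0_abs z * a).
Proof.
move=> [a0 [u Uu ->]]; rewrite scalerA; apply: gauge_set_abs => //.
by rewrite L0_absM L0_abs_of_real.
Qed.

(** a u + b v is a + b times the convex combination of u and v with weights
    a / (a + b) and its complement to 1; where a + b vanishes so do a and b, and
    the value 0 of the quotient is harmless. *)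
Lemma gauge_setD x y a b :
  gauge_set x a -> gauge_set y b -> gauge_set (x + y) (a + b).
Proof.
move=> [a0 [u Uu ->]] [b0 [v Uv ->]]; split; first exact: L0_addr_ge0.
have aab : L0_abs a <= a + b.
  by rewrite L0_ge0_abs// -[leLHS]addr0; exact: L0_lerD.
have := L0_divfK aab; have := L0_abs_div_le1 aab; rewrite L0_of_real_id.
set t := a * _ => t1 abt.
have t0 : 0 <= t by apply/L0_mulr_ge0/L0_invr_ge0/L0_addr_ge0.
rewrite L0_ge0_abs// in t1.
exists (L0_of_real k t *: u + L0_of_real k (1 - t) *: v); first exact: Uc.
rewrite scalerDr !scalerA -!L0_of_realM mulrBr mulr1 abt.
by rewrite [a + b]addrC addrK.
Qed.

Section Infimum.
Variable p : E -> L0 P RealScalars.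
Hypotheses (p_lb : forall x a, gauge_set x a -> p x <= a)
  (p_glb : forall x b, (forall a, gauge_set x a -> b <= a) -> b <= p x).

Lemma gauge_ge0 x : 0 <= p x.
Proof. by apply: p_glb => a []. Qed.

Lemma gaugeD x y : p (x + y) <= p x + p y.
Proof.
rewrite -L0_lerBlDr; apply: p_glb => a xa.
rewrite L0_lerBlDr [a + _]addrC -L0_lerBlDr; apply: p_glb => b yb.
by rewrite L0_lerBlDr [b + _]addrC; apply: p_lb; exact: gauge_setD.
Qed.

(** Dividing by |z| where it does not vanish turns the bound p (z x) <= |z| a
    into a lower bound of the a; where z vanishes, so does p (z x). *)
Lemma gaugeZ_le z x : p (z *: x) <= L0_abs z * p x.
Proof.
have [a0 xa0] := gauge_set_neq0 x.
rewrite -(L0_mulVK (gauge_ge0 _) (p_lb (gauge_setZ z xa0))).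
apply: L0_ler_wpM2l; first exact: L0_abs_ge0.
apply: p_glb => a xa; have [a_ge0 _] := xa.
apply: le_trans (L0_ler_wpM2l _ (p_lb (gauge_setZ z xa))) _.
  by apply: L0_invr_ge0; exact: L0_abs_ge0.
rewrite mulrA mulrC -[leRHS]mulr1; apply: L0_ler_wpM2l => //.
rewrite mulrC -[leLHS]L0_ge0_abs; first exact: L0_mulV_le1.
apply: L0_mulr_ge0; first exact: L0_abs_ge0.
by apply: L0_invr_ge0; exact: L0_abs_ge0.
Qed.

(** For the reverse inequality, split x along the support of z: z / z is the
    indicator of the support, x = z^-1 (z x) + (1 - z / z) x, and the second
    term disappears after multiplication by |z|. *)
Lemma gaugeZ z x : p (z *: x) = L0_abs z * p x.
Proof.
apply/le_anti; rewrite gaugeZ_le /=.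
have /L0_ler_wpM2l : p x <= L0_abs (L0_inv z) * p (z *: x) +
    L0_abs (1 - L0_inv z * z) * p x.
  rewrite -[X in p X <= _](_ : L0_inv z *: (z *: x) +
      (1 - L0_inv z * z) *: x = x); last first.
    by rewrite scalerBl scale1r scalerA addrC subrK.
  by apply: le_trans (gaugeD _ _) _; apply: L0_lerD; exact: gaugeZ_le.
move=> /(_ _ (L0_abs_ge0 z)) /le_trans; apply.
rewrite mulrDr !mulrA -!L0_absM L0_mul_subV L0_abs0 mul0r addr0.
rewrite mulrC -[leRHS]mulr1; apply: L0_ler_wpM2l; first exact: gauge_ge0.
exact: L0_mulV_le1.
Qed.

End Infimum.

(** The events s n < 1 are made disjoint.  On the n-th piece A, x = (s n) u with
    u in U, and 1_A x = (1_A s n) u lies in U because |1_A s n| <= 1; so x is a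
    concatenation of elements of U. *)
Lemma gauge_lt1 x (s : nat -> L0 P RealScalars) :
  relative_countable_concatenation U ->
  (forall n, gauge_set x (s n)) ->
  (\forall w \ae P, exists n, (s n w : R) < 1) -> U x.
Proof.
move=> Ucc sG s1.
pose D n := [set w | (s n w : R) < 1].
have mD n : measurable (D n).
  rewrite [D n](_ : _ = s n @^-1` `]-oo, 1[%classic).
    by rewrite -[_ @^-1` _]setTI; exact: L0_measurable_real.
  by apply/seteqP; split=> w /=; rewrite in_itv.
(* The null complement of the cover comes first, to obtain a true partition. *)
pose D' n := if n is m.+1 then D m else ~` \bigcup_n D n.
have mD' n : measurable (D' n).
  by case: n => [|n] //=; apply/measurableC/bigcupT_measurable.
pose A := seqDU D'.
have mA n : measurable (A n).
  by apply: measurableD => //; exact: bigsetU_measurable.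
have AD n : A n `<=` D' n by move=> w [].
pose y n := if n is m.+1 then L0_indic k (mA n) *: x else 0.
have xy : concatenations mA y x.
  case=> [|n] /=.
    rewrite scaler0 (_ : L0_indic k (mA 0%N) = 0) ?scale0r//.
    apply: L0_eq_ae; apply: filterS s1 => w [n sw]; rewrite indicE.
    by case: (boolP (w \in _)) => //; rewrite inE => /AD[]; exists n.
  rewrite scalerA; congr (_ *: _); apply: L0_eq_ae; apply: aeW => w.
  by rewrite indicE; case: (_ \in _); rewrite ?mulr1// mulr0.
apply: (Ucc y A mA _ (@trivIset_seqDU _ D') _ _ x xy); last by exists x.
- case=> [|n]; first exact: balanced0.
  rewrite /y; have [sn0 [u Uu ->]] := sG n.
  rewrite scalerA; apply: Ub => //.
  rewrite L0_absM L0_abs_indic L0_abs_of_real//.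
  apply: L0_le_ae; apply: aeW => w.
  rewrite indicE; case: (boolP (w \in _)); rewrite ?mul0r ?mul1r// inE.
  by move=> /AD /ltW.
- rewrite -seqDU_bigcup_eq; apply/seteqP; split=> // w _.
  have [[n _ Dw]|nD] := pselect ((\bigcup_n D n) w); first by exists n.+1.
  by exists 0%N.
Qed.

Lemma gauge_seminorm : relative_countable_concatenation U ->
  exists p : E -> L0 P RealScalars, [/\ L0_seminorm p,
    forall a u, 0 <= a -> U u -> p (L0_of_real k a *: u) <= a
  & forall x, (\forall w \ae P, (p x w : R) < 1) -> U x].
Proof.
move=> Ucc.
have /choice[p p_inf] x := essential_infimum (gauge_set_neq0 x)
  (fun a (xa : gauge_set x a) => xa.1).
have p_lb x a : gauge_set x a -> p x <= a by have [+ _ _] := p_inf x; exact.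
have p_glb x b : (forall a, gauge_set x a -> b <= a) -> b <= p x.
  by have [_ + _] := p_inf x; exact.
exists p; split.
- split; [exact: gauge_ge0|exact: gaugeZ|exact: gaugeD].
- by move=> a u a0 Uu; apply: p_lb; split=> //; exists u.
- move=> x px1; have [_ _ [s sG sp]] := p_inf x.
  by apply: (gauge_lt1 Ucc sG); apply: filterS2 px1 sp => w pw; apply.
Qed.

End Gauge.

(** * The topology of a module and its seminorms *)

Section Topology.
Context d (T : measurableType d) (R : realType) (P : probability T R).
Context (k : scalar_kind) (E : lmodType (L0 P k)) (tau : topology E).
Implicit Types (S : set (E -> L0 P RealScalars)).
Local Notation nbhs_tau x := (nbhs (x : topologized tau)).

(** The interior of the ball is the set W of the points around which a smaller
    ball of the same seminorms fits; W is open because radii can be halved. *)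
Lemma seminorm_ball_nbhs S Q e : (forall p, S p -> L0_seminorm p) ->
  induced_by tau S -> finite_set Q -> Q `<=` S -> L0_pos P e ->
  nbhs_tau 0 (seminorm_ball Q e).
Proof.
move=> Ss tauS finQ QS e0.
have Qs p : Q p -> L0_seminorm p by move=> /QS /Ss.
pose W : set E := [set y | exists2 r, L0_pos P r &
  [set y + x | x in seminorm_ball Q r] `<=` seminorm_ball Q e].
have oW : is_open tau W.
  apply/tauS => y [r r0 yrW].
  have [h h0 hhr] := L0_half_exists r0.
  exists Q, h; split=> // _ [x xh <-]; exists h => // _ [z zh <-].
  apply: yrW; exists (x + z); last by rewrite addrA.
  by rewrite -hhr; exact: (seminorm_ballD Qs).
rewrite nbhsE; exists (W : set (topologized tau)); first split => //.
- by exists e => // _ [x xe <-]; rewrite add0r.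
- move=> y [r r0 yrW]; apply: yrW; exists 0; last by rewrite addr0.
  exact: seminorm_ball0.
Qed.

Lemma seminorm_ball_base S : (forall p, S p -> L0_seminorm p) ->
  induced_by tau S ->
  neighborhood_base tau 0 [set U | exists Q e,
    [/\ finite_set Q, Q `<=` S, L0_pos P e & U = seminorm_ball Q e]].
Proof.
move=> Ss tauS; split.
  by move=> _ [Q [e [finQ QS e0 ->]]]; exact: (seminorm_ball_nbhs Ss tauS).
move=> V; rewrite nbhsE => -[W [oW W0] WV].
have [/(_ oW 0 W0)[Q [e [finQ QS e0 QW]]] _] := tauS W.
exists (seminorm_ball Q e); first by exists Q, e.
by move=> x xQ; apply/WV/QW; exists x => //; rewrite add0r.
Qed.

Section Module.
Hypothesis tauM : topological_L0_module tau.

Lemma nbhs_translate (y x : E) (V : set E) :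
  nbhs_tau (y + x) V -> nbhs_tau x [set z | V (y + z)].
Proof.
move=> yxV.
have /= := tauM.1 (y, x) V yxV.
move=> [[A B] /= [Ay Bx] ABV].
apply: filterS Bx => z Bz; apply: (ABV (y, z)); split=> //=.
exact: (@nbhs_singleton (topologized tau) y A Ay).
Qed.

Lemma nbhs_scale (a : L0 P k) (x : E) (V : set E) :
  nbhs_tau (a *: x) V -> nbhs_tau x [set z | V (a *: z)].
Proof.
move=> axV.
have /= := tauM.2 (a, x) V axV.
move=> [[A B] /= [Ay Bx] ABV].
apply: filterS Bx => z Bz; apply: (ABV (a, z)); split=> //=.
exact: (@nbhs_singleton (L0 P k) a A Ay).
Qed.

(** Only two properties of gauges matter, one inclusion in each direction, and
    they make the topologies agree at 0.  The radius 1/2 provides the strict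
    inequality below 1, and the ball of radius e contains the intersection of
    the finitely many neighborhoods e U. *)
Lemma induced_by_gauges (B : set (set E)) (S : set (E -> L0 P RealScalars)) :
  neighborhood_base tau 0 B ->
  (forall p, S p -> exists2 U, B U & forall (a : L0 P RealScalars) u,
     0 <= a -> U u -> p (L0_of_real k a *: u) <= a) ->
  (forall U, B U -> exists2 p, S p &
     forall x, (\forall w \ae P, (p x w : R) < 1) -> U x) ->
  induced_by tau S.
Proof.
move=> [B0 Bb] SB BS V; split=> [oV y Vy|VS].
  have : nbhs_tau 0 [set z | V (y + z)].
    by apply: nbhs_translate; rewrite addr0; exact: open_nbhs_nbhs.
  move=> /Bb[U BU UV]; have [p Sp pU] := BS U BU.
  have [h h0 hh1] := L0_half_exists (L0_pos1 P).
  exists [set p], h; split=> //; first by move=> _ ->.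
  move=> _ [x xh <-]; apply/UV/pU.
  have /L0_leE ph := xh p erefl.
  have /L0_eqE hh := hh1.
  apply: filterS3 h0 ph hh => w hw pw <-; apply: le_lt_trans pw _.
  by rewrite ltrDl.
suff : open (V : set (topologized tau)) by [].
rewrite openE => y Vy; rewrite /interior.
have [Q [e [finQ QS e0 QV]]] := VS y Vy.
have ballQ : nbhs_tau 0 (seminorm_ball Q e).
  move: QS {QV}; elim/finite_set_ind : finQ => [_|p A IH pAS].
    by apply: filterS filterT => x _ p [].
  have /SB[U /B0 U0 pU] : S p by apply: pAS; left.
  have eU : nbhs_tau 0 [set x | U (L0_of_real k (L0_inv e) *: x)].
    by apply: nbhs_scale; rewrite scaler0.
  have /IH Ae : A `<=` S by move=> q Aq; apply: pAS; right.
  apply: filterS2 eU Ae => x eUx Aex q [->|]; last exact: Aex.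
  have := pU e _ (L0_pos_ge0 e0) eUx.
  by rewrite scalerA -L0_of_realM L0_mulfV// L0_of_real1 scale1r.
have := @nbhs_translate (- y) y (seminorm_ball Q e); rewrite addNr.
move=> /(_ ballQ); apply: filterS => z zQ; apply: QV.
by exists (- y + z) => //; rewrite addNKr.
Qed.

End Module.
End Topology.

Theorem theorem3p10 (d : measure_display) (Omega : measurableType d)
    (R : realType) (P : probability Omega R) (K : scalar_kind)
    (E : lmodType (L0 P K)) (tau : topology E) :
  topological_L0_module tau ->
  ((exists S : set (E -> L0 P RealScalars),
      (forall p, S p -> L0_seminorm p) /\ induced_by tau S) <->
   (exists B : set (set E),
      neighborhood_base tau 0 B /\
      forall U, B U ->
        [/\ L0_convex U, L0_absorbent U, L0_balanced U
          & relative_countable_concatenation U])).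
Proof.
move=> tauM; split=> [[S [Ss tauS]]|[B [Bb BU]]].
  eexists; split; first exact: seminorm_ball_base tauS.
  move=> _ [Q [e [finQ QS e0 ->]]].
  have Qs p : Q p -> L0_seminorm p by move=> /QS /Ss.
  split.
  - exact: seminorm_ball_convex.
  - exact: seminorm_ball_absorbent.
  - exact: seminorm_ball_balanced.
  - exact: seminorm_ball_concatenation.
exists [set p | L0_seminorm p /\ exists2 U, B U &
  forall (a : L0 P RealScalars) u,
    0 <= a -> U u -> p (L0_of_real K a *: u) <= a].
split; first by move=> p [].
apply: (induced_by_gauges tauM Bb) => [p [_ [U U1 U2]]|U UB].
  by exists U.
have [Uc Ua Ub Ucc] := BU U UB.
have [p [ps pU p1]] := gauge_seminorm Uc Ua Ub Ucc.
by exists p => //; split=> //; exists U.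
Qed.
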